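(* Let $S\subset\mathbb{Z}_+$ be a proper cofinite set of positive integers, $f(x)=1-\sum_{k\in S}x^k$, $p$ the smallest root of $f$ and $r$ the magnitude of the second smallest root. Let $E_n$ denote expectation with respect to the uniform probability measure on the set of $S$-restricted compositions of $n$, and let $\mathbf{B}(\vec\lambda)=\prod_i\lambda_i$ be the product of the parts. There exist constants $a_1>0$ and $a_0$ such that, for any $q\in(p,\min(1,r))$, $$E_n(\log\mathbf{B})=a_1n+a_0+O\!\left(n\left(\tfrac{p}{q}\right)^n\right).$$ Specifically, $$a_1=\frac{\sum(\log k)p^k}{\sum kp^k},\qquad a_0=\frac{\sum(\log k)p^k\,\sum k^2p^k}{\left(\sum kp^k\right)^2}-\frac{\sum k(\log k)p^k}{\sum kp^k},$$ where all sums are over $k\in S$.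
   Context: ''Proper cofinite'' means $\mathbb{Z}_+\setminus S$ is finite and nonempty. An $S$-restricted composition of $n$ is a finite sequence $(\lambda_1,\dots,\lambda_\ell)$ of elements of $S$ summing to $n$. The function $f$ extends to a rational function on $\mathbb{C}$ (using $\sum_{k\ge1}x^k=x/(1-x)$) whose roots are the zeros of the polynomial $(1-x)f(x)$. The root of smallest magnitude is a real number $p\in(\tfrac12,1)$ of multiplicity one and all other roots have magnitude strictly greater than $p$; $r$ denotes the minimum of $|z|$ over roots $z\ne p$ of $f$. *)

(* Defs.v *)
From HB Require Import structures.
From mathcomp Require Export all_boot all_order all_algebra finmap.
From mathcomp Require Export complex.
From mathcomp Require Export all_classical all_reals all_analysis.
Export Order.TTheory GRing.Theory Num.Theory numFieldNormedType.Exports.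

Set Implicit Arguments.
Unset Strict Implicit.
Unset Printing Implicit Defensive.

Local Open Scope classical_set_scope.
Local Open Scope complex_scope.
Local Open Scope ring_scope.

Definition positive_integers : set nat := [set k | (0 < k)%N].

Definition gaps (S : set nat) : set nat := positive_integers `\` S.

Definition proper_cofinite (S : set nat) : Prop :=
  [/\ S `<=` positive_integers, finite_set (gaps S) & gaps S !=set0].

Definition compositions (S : set nat) (n : nat) : set (seq nat) :=
  [set l : seq nat | (forall k, k \in l -> S k) /\ sumn l = n].

Definition part_product (l : seq nat) : nat := (\prod_(k <- l) k)%N.

(* Expectation of X under the uniform probability measure on the finite set A.
   It is 0 when A is empty, which for compositions of n happens for finitely
   many n only. *)
Definition uniform_expectation (R : realType) (T : choiceType) (A : set T)
    (X : T -> R) : R :=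
  (\sum_(t \in A) X t) / (#|` fset_set A|)%:R.

Definition series_over (R : realType) (S : set nat) (u : nat -> R) : R :=
  \big[+%R/0]_(0 <= k <oo | k \in S) u k.

(* The rational extension of f(z) = 1 - \sum_(k in S) z^k, obtained from
   \sum_(k >= 1) z^k = z / (1 - z) by removing the finitely many gaps of S. *)
Definition f_ext (R : realType) (S : set nat) (z : R[i]) : R[i] :=
  1 - (z / (1 - z) - \sum_(t \in gaps S) z ^+ t).

(* The polynomial (1 - x) f(x). *)
Definition f_num (R : realType) (S : set nat) : {poly R[i]} :=
  (1 - 'X) - ('X - (1 - 'X) * \sum_(t \in gaps S) ('X^t : {poly R[i]})).

Definition f_root (R : realType) (S : set nat) (z : R[i]) : Prop :=
  root (f_num R S) z.

Definition smallest_root (R : realType) (S : set nat) (p : R) : Prop :=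
  f_root S p%:C /\ forall z : R[i], f_root S z -> `|p%:C| <= `|z|.

Definition second_root_magnitude (R : realType) (S : set nat) (p r : R) : Prop :=
  (exists z : R[i], [/\ f_root S z, z != p%:C & `|z| = r%:C]) /\
  forall z : R[i], f_root S z -> z != p%:C -> r%:C <= `|z|.

Lemma f_numE (R : realType) (S : set nat) (z : R[i]) :
  finite_set (gaps S) -> z != 1 -> (f_num R S).[z] = (1 - z) * f_ext S z.
Proof.
move=> finS z1; rewrite /f_num /f_ext !fsbig_finite//=.
rewrite !hornerE horner_sum (eq_bigr (fun t => z ^+ t)) => [|t _]; last by rewrite hornerXn.
have z1' : 1 - z != 0 by rewrite subr_eq0 eq_sym.
by rewrite !mulrBr mulr1 [(1 - z) * (z / _)]mulrC divfK.
Qed.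

Lemma f_rootE (R : realType) (S : set nat) (z : R[i]) :
  finite_set (gaps S) -> f_root S z <-> z != 1 /\ f_ext S z = 0.
Proof.
move=> finS; rewrite /f_root /root; split=> [fz|[z1 fz]]; last first.
  by rewrite f_numE// fz mulr0.
have z1 : z != 1.
  apply: contraTneq fz => ->.
  by rewrite /f_num !hornerE subrr mul0r !subr0 sub0r oppr_eq0 oner_eq0.
split=> //; move: fz; rewrite f_numE// mulf_eq0 subr_eq0 eq_sym (negbTE z1)/=.
by move/eqP.
Qed.

Lemma cvg_expC (R : realType) (z : R[i]) :
  `|z| < 1 -> (fun n => z ^+ n : R[i]^o) @ \oo --> (0 : R[i]^o).
Proof.
move=> z1; apply/cvgr0Pnorm_lt => e e0.
pose x : R := complex.Re `|z|; pose d : R := complex.Re (e : R[i]).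
have eE : e = d%:C by rewrite RRe_real// gtr0_real.
have zE : `|z| = x%:C by rewrite RRe_real// normr_real.
have d0 : 0 < d by rewrite -ltcR -eE.
have x0 : 0 <= x by rewrite -lecR -zE; exact: normr_ge0.
have x1 : x < 1 by rewrite -ltcR -zE.
have /cvgr0Pnorm_lt/(_ _ d0) : (fun n => x ^+ n) @ \oo --> (0 : R).
  by apply: cvg_expr; rewrite ger0_norm.
apply: filterS => n.
rewrite ger0_norm ?exprn_ge0// eE => xd.
by rewrite [ltLHS](normrX n z) zE -rmorphXn ltcR.
Qed.

Lemma f_ext_series (R : realType) (S : set nat) (z : R[i]) :
  proper_cofinite S -> `|z| < 1 ->
  (fun n => 1 - \sum_(0 <= k < n | k \in S) z ^+ k : R[i]^o) @ \oo
    --> (f_ext S z : R[i]^o).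
Proof.
move=> [Spos finS _] z1.
have z1' : 1 - z != 0.
  by apply: contraTneq z1 => /eqP; rewrite subr_eq0 => /eqP <-; rewrite normr1 ltxx.
rewrite /f_ext fsbig_finite//=.
set F := fset_set _.
have FP k : (k \in F) = (k \in gaps S) by rewrite in_fset_set.
have [N FN] : exists N, forall k, k \in F -> (k < N)%N.
  exists (\max_(k <- F) k).+1 => k kF.
  by rewrite ltnS; exact: (@leq_bigmax_seq _ _ xpredT id).
have main n : (N <= n)%N -> (0 < n)%N ->
    1 - \sum_(0 <= k < n | k \in S) z ^+ k =
    1 - ((1 - z ^+ n) / (1 - z) - 1 - \sum_(t <- F) z ^+ t).
  move=> Nn n0; congr (1 - _).
  have -> : \sum_(t <- F) z ^+ t = \sum_(0 <= t < n | t \in F) z ^+ t.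
    rewrite -[RHS]big_filter; apply: perm_big; apply: uniq_perm.
    - exact: fset_uniq.
    - by rewrite filter_uniq// iota_uniq.
    - move=> k; rewrite mem_filter mem_index_iota /=.
      by case: (boolP (k \in F)) => //= /FN kN; rewrite (leq_trans kN Nn).
  have -> : (1 - z ^+ n) / (1 - z) = \sum_(0 <= k < n) z ^+ k.
    rewrite -[1 - z ^+ n]opprB subrX1 -mulNr opprB mulrC mulKf// big_mkord.
    by [].
  rewrite [in RHS](bigID (mem S))/=.
  suff -> : \sum_(0 <= k < n | k \notin S) z ^+ k
      = 1 + \sum_(0 <= t < n | t \in F) z ^+ t :> R[i].
    by rewrite [1 + _]addrC !addrA !addrK.
  rewrite [LHS]big_mkcond [X in _ = _ + X]big_mkcond/=.
  rewrite [LHS]big_ltn// [X in _ = _ + X]big_ltn//.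
  have -> : (0%N \in S) = false by apply/negbTE/negP => /set_mem /Spos.
  have -> : (0%N \in F) = false by rewrite FP; apply/negbTE/negP => /set_mem [].
  rewrite expr0 add0r; congr (1 + _); apply: eq_big_nat => k /andP[k0 _].
  rewrite FP /gaps in_setD.
  have -> : k \in positive_integers by apply/mem_set.
  by [].
apply: (@cvg_trans _ ((fun n => 1 - ((1 - z ^+ n) / (1 - z) - 1
    - \sum_(t <- F) z ^+ t)) @ \oo)).
  apply: near_eq_cvg; exists (maxn N 1) => // n /=.
  by rewrite geq_max => /andP[Nn n0]; rewrite main.
have -> : z / (1 - z) = (1 - 0) / (1 - z) - 1.
  by apply: (mulIf z1'); rewrite mulrBl !divfK// mul1r subr0 opprB addrC subrK.
have aux (K : numFieldType) (u : nat -> K) (c s : K) : u @ \oo --> (0 : K) ->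
    (fun n => 1 - ((1 - u n) * c - 1 - s)) @ \oo --> 1 - ((1 - 0) * c - 1 - s).
  move=> u0; apply: cvgB; first exact: cvg_cst.
  apply: cvgB; last exact: cvg_cst.
  apply: cvgB; last exact: cvg_cst.
  apply: cvgM; last exact: cvg_cst.
  by apply: cvgB => //; exact: cvg_cst.
exact: (aux R[i] (fun n => z ^+ n) _ _ (cvg_expC z1)).
Qed.

Lemma finite_compositions (S : set nat) (n : nat) :
  S `<=` positive_integers -> finite_set (compositions S n).
Proof.
move=> Spos.
pose g (t : {m : 'I_n.+1 & m.-tuple 'I_n.+1}) : seq nat :=
  map val (tagged t).
apply: (@sub_finite_set _ _ (range g)); last exact/finite_image/finite_finset.
move=> l [lS ln].
have le_part k : k \in l -> (k < n.+1)%N.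
  move=> kl; rewrite ltnS -ln; elim: l kl {lS ln} => //= a l IH.
  rewrite inE => /predU1P[->|/IH h]; first exact: leq_addr.
  exact: leq_trans h (leq_addl _ _).
have le_size : (size l < n.+1)%N.
  rewrite ltnS -ln; elim: l lS {le_part ln} => //= a l IH lS.
  have a0 : (0 < a)%N by apply/Spos/lS; rewrite mem_head.
  rewrite -add1n leq_add// IH// => k kl; apply: lS.
  by rewrite in_cons kl orbT.
pose s : seq 'I_n.+1 := map inord l.
have ss : size s == Ordinal le_size by rewrite size_map.
exists (Tagged (fun m : 'I_n.+1 => m.-tuple 'I_n.+1)
          (Tuple ss : (Ordinal le_size).-tuple 'I_n.+1)) => //.
rewrite /g /= /s -map_comp -[RHS]map_id; apply/eq_in_map => k /le_part kn.
by rewrite /= inordK.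
Qed.

(* Main.v *)
From HB Require Import structures.
Require Import Defs.
From mathcomp Require Import ring lra zify.

Set Implicit Arguments.
Unset Strict Implicit.
Unset Printing Implicit Defensive.

Local Open Scope classical_set_scope.
Local Open Scope ring_scope.

(** Put [sigma = \sum_(k in S) p^k X^k] and, for a weight [w] on the parts,
    [l = \sum_(k in S) w k p^k X^k]; let [c] and [b] be the generating functions, in
    the variable [p X], of the number of compositions of [n] and of the sum of the
    weights of their parts.  Then [(1 - sigma) c = 1] and [(1 - sigma) b = l c].
    Since [sigma] takes the value [1] at [1], it equals [1 - nabla t] with
    [nabla = 1 - X], so [h = nabla c] is the inverse of [t] and [nabla^2 b = l h^2].
    Thus [c] has a simple pole and [b] a double pole at [1], and their coefficients
    are read off the Taylor expansions of [h] and [l h^2] at [1].  The remainders are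
    [O((p / q)^n)] because [h] is absolutely summable at [q / p]: [(1 - p X) t] is a
    polynomial, its roots are the [z / p] for the roots [z <> p] of [f] ([p] being a
    simple root, because [sigma'(1) > 0]), and these have modulus greater than [q / p].
    For [w = ln] the weights of the parts add up to the logarithm of their product. *)

(** * Formal power series *)

Definition fps (K : Type) : Type := nat -> K.

HB.instance Definition _ (K : comNzRingType) := GRing.Zmodule.copy (fps K) (nat -> K).

Definition fps_of_poly (K : comNzRingType) (p : {poly K}) : fps K := fun n => p`_n.

Notation "p %:FPS" := (fps_of_poly p) (at level 1, left associativity, format "p %:FPS").

Section FormalPowerSeries.
Variable K : comNzRingType.
Implicit Types (u v w : fps K) (p q : {poly K}) (a : K).

Definition fps_mul u v : fps K := fun n => \sum_(i < n.+1) u i * v (n - i)%N.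

(* Associativity and commutativity are inherited from polynomials, by truncation. *)
Let trunc (n : nat) u : {poly K} := \poly_(i < n.+1) u i.

Let coef_trunc n u i : (i <= n)%N -> (trunc n u)`_i = u i.
Proof. by move=> le_in; rewrite coef_poly ltnS le_in. Qed.

Let fps_mul_trunc N u v n : (n <= N)%N -> fps_mul u v n = (trunc N u * trunc N v)`_n.
Proof.
move=> le_nN; rewrite coefM; apply: eq_bigr => i _.
have le_iN : (i <= N)%N by rewrite (leq_trans _ le_nN)// -ltnS.
by rewrite !coef_trunc// (leq_trans (leq_subr _ _) le_nN).
Qed.

Lemma fps_mulC : commutative fps_mul.
Proof. by move=> u v; apply/funext => n; rewrite !(fps_mul_trunc _ _ (leqnn n)) mulrC. Qed.

Lemma fps_mulA : associative fps_mul.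
Proof.
move=> u v w; apply/funext => n.
transitivity ((trunc n u * (trunc n v * trunc n w))`_n).
  rewrite coefM; apply: eq_bigr => i _.
  rewrite coef_trunc; last by rewrite -ltnS.
  by rewrite (fps_mul_trunc (N := n))// leq_subr.
rewrite mulrA coefM; apply: eq_bigr => i _.
rewrite coef_trunc ?leq_subr// (fps_mul_trunc (N := n))//.
by rewrite -ltnS.
Qed.

Lemma fps_of_polyM p q : (p * q)%:FPS = fps_mul p%:FPS q%:FPS.
Proof. by apply/funext => n; rewrite /fps_of_poly coefM. Qed.

Lemma fps_mul1 : left_id 1%:FPS fps_mul.
Proof.
move=> u; apply/funext => n.
rewrite /fps_mul big_ord_recl /= subn0 /fps_of_poly coef1 mul1r.
by rewrite big1 ?addr0// => i _; rewrite coef1 mul0r.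
Qed.

Lemma fps_mulDl : left_distributive fps_mul +%R.
Proof.
move=> u v w; apply/funext => n; transitivity (fps_mul u w n + fps_mul v w n) => //.
rewrite /fps_mul -big_split /=.
by apply: eq_bigr => i _; rewrite -mulrDl.
Qed.

Lemma fps1_neq0 : 1%:FPS != 0 :> fps K.
Proof.
apply/eqP => /(congr1 (fun u : fps K => u 0%N)) /eqP.
by rewrite /fps_of_poly coef1 /= oner_eq0.
Qed.

HB.instance Definition _ := GRing.Zmodule_isComNzRing.Build (fps K)
  fps_mulA fps_mulC fps_mul1 fps_mulDl fps1_neq0.

Lemma fps_of_poly_is_zmod_morphism : zmod_morphism (@fps_of_poly K).
Proof. by move=> p q; apply/funext => n; rewrite /fps_of_poly coefB. Qed.

Lemma fps_of_poly_is_monoid_morphism : monoid_morphism (@fps_of_poly K).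
Proof. by split=> // p q; rewrite fps_of_polyM. Qed.

HB.instance Definition _ := GRing.isZmodMorphism.Build {poly K} (fps K)
  (@fps_of_poly K) fps_of_poly_is_zmod_morphism.
HB.instance Definition _ := GRing.isMonoidMorphism.Build {poly K} (fps K)
  (@fps_of_poly K) fps_of_poly_is_monoid_morphism.

Lemma fpsE :
  ((forall u v n, (u + v) n = u n + v n) * (forall u n, (- u) n = - u n)) *
  (forall p n, p%:FPS n = p`_n).
Proof. by []. Qed.

Lemma fpsM u v n : (u * v) n = \sum_(i < n.+1) u i * v (n - i)%N.
Proof. by []. Qed.

Lemma fps1 n : (1 : fps K) n = (n == 0%N)%:R.
Proof. by rewrite -coef1. Qed.

Lemma fpsCM a u n : (a%:P%:FPS * u) n = a * u n.
Proof.
rewrite fpsM big_ord_recl /= subn0 fpsE coefC /= big1 ?addr0// => i _.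
by rewrite fpsE coefC mul0r.
Qed.

Lemma fpsXM u n : ('X%:FPS * u) n = if n is n'.+1 then u n' else 0.
Proof.
rewrite fpsM big_ord_recl !fpsE coefX mul0r add0r.
case: n => [|n]; first by rewrite big_ord0.
rewrite big_ord_recl fpsE coefX mul1r big1 ?addr0 /= ?subSS ?subn0// => i _.
by rewrite fpsE coefX mul0r.
Qed.

Definition fps_geometric a : fps K := fun n => a ^+ n.

Lemma fps_geometricP a : (1 - (a *: 'X)%:FPS) * fps_geometric a = 1.
Proof.
apply/funext => n.
rewrite mulrBl mul1r -mul_polyC rmorphM -mulrA !fpsE fpsCM fpsXM fps1 /fps_geometric.
by case: n => [|n]; rewrite ?mulr0 ?subr0// exprS subrr.
Qed.

Lemma fps_geometric_sqr a n : (fps_geometric a * fps_geometric a) n = a ^+ n *+ n.+1.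
Proof.
rewrite fpsM (eq_bigr (fun=> a ^+ n)) ?sumr_const ?card_ord// => i _.
by rewrite /fps_geometric -exprD subnKC// -ltnS.
Qed.

Definition nabla : fps K := 1 - 'X%:FPS.

Lemma nabla_geometric : nabla * fps_geometric 1 = 1.
Proof. by have := fps_geometricP 1; rewrite scale1r. Qed.

Lemma mul_geometric1 u n : (u * fps_geometric 1) n = series u n.+1.
Proof.
rewrite fpsM seriesEord; apply: eq_bigr => i _.
by rewrite /fps_geometric expr1n mulr1.
Qed.

Lemma nabla_inj : injective ( *%R nabla).
Proof.
apply: (can_inj (g := *%R (fps_geometric 1))) => u.
by rewrite mulrA [_ * nabla]mulrC nabla_geometric mul1r.
Qed.

End FormalPowerSeries.

Arguments nabla {K}.

Section FpsMap.
Variables (K L : comNzRingType) (f : {rmorphism K -> L}).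

Definition fps_map (u : fps K) : fps L := fun n => f (u n).

Lemma fps_mapM u v : fps_map (u * v) = fps_map u * fps_map v.
Proof.
apply/funext => n; rewrite /fps_map !fpsM rmorph_sum.
by apply: eq_bigr => i _; rewrite rmorphM.
Qed.

Lemma fps_map_poly p : fps_map p%:FPS = (map_poly f p)%:FPS.
Proof. by apply/funext => n; rewrite /fps_map !fpsE coef_map. Qed.

End FpsMap.

(** * Weighted summability *)

Lemma sum_convolution (K : pzSemiRingType) (a b : nat -> K) N :
  \sum_(n < N) \sum_(i < n.+1) a i * b (n - i)%N =
  \sum_(i < N) a i * \sum_(j < N - i) b j.
Proof.
elim: N => [|N IH]; first by rewrite !big_ord0.
rewrite big_ord_recr [RHS]/= IH [LHS]/=.
rewrite [in RHS](eq_bigr (fun i : 'I_N.+1 => a i * \sum_(j < N - i) b j + a i * b (N - i)%N)).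
  by rewrite big_split /= [in RHS]big_ord_recr /= subnn big_ord0 mulr0 addr0.
by move=> i _; rewrite subSn -1?ltnS// big_ord_recr mulrDr.
Qed.

Section WeightedSummability.
Variables (K : numFieldType) (s : K).
Implicit Types (u v : fps K) (p : {poly K}) (z : K).

(* Keeping the weight inside the norm makes [wsummable s] a subring for every [s]. *)
Definition wsummable_pred : {pred fps K} :=
  fun u => `[< exists M, forall N, \sum_(i < N) `|u i * s ^+ i| <= M >].

Definition wsummable := [qualify a u : fps K | wsummable_pred u].

Lemma wsummableP u :
  reflect (exists M, forall N, \sum_(i < N) `|u i * s ^+ i| <= M) (u \is a wsummable).
Proof. exact: asboolP. Qed.

Lemma le_wsummable u v : (forall n, `|u n| <= `|v n|) ->
  v \is a wsummable -> u \is a wsummable.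
Proof.
move=> le_uv /wsummableP[M vM]; apply/wsummableP; exists M => N.
by apply: le_trans (vM N); apply: ler_sum => i _; rewrite !normrM ler_wpM2r.
Qed.

Lemma wsummable_poly p : p%:FPS \is a wsummable.
Proof.
pose F i := `|p`_i * s ^+ i|; apply/wsummableP; exists (\sum_(i < size p) F i) => N.
have F_ge0 i : 0 <= F i by exact: normr_ge0.
have F0 i : (size p <= i)%N -> F i = 0.
  by move=> le_pi; rewrite /F nth_default// mul0r normr0.
rewrite -[leLHS](big_mkord xpredT F) -(big_mkord xpredT F).
have [le_pN|/ltnW le_Np] := leqP (size p) N.
  rewrite (big_cat_nat (leq0n _) le_pN) /= [X in _ + X]big_nat_cond.
  by rewrite [X in _ + X]big1 ?addr0// => i /andP[/andP[/F0]].
by rewrite [leRHS](big_cat_nat (leq0n _) le_Np) /= lerDl sumr_ge0.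
Qed.

Lemma wsummableM u v : u \is a wsummable -> v \is a wsummable -> u * v \is a wsummable.
Proof.
move=> /wsummableP[M uM] /wsummableP[M' vM']; apply/wsummableP; exists (M * M') => N.
have M'_ge0 : 0 <= M' by have := vM' 0%N; rewrite big_ord0.
pose a n := `|u n * s ^+ n|; pose b n := `|v n * s ^+ n|.
apply: (@le_trans _ _ (\sum_(n < N) \sum_(i < n.+1) a i * b (n - i)%N)).
  apply: ler_sum => n _; rewrite fpsM mulr_suml.
  apply: le_trans (ler_norm_sum _ _ _) _; apply: ler_sum => i _.
  by rewrite /a /b -normrM mulrACA -exprD subnKC// -ltnS.
rewrite sum_convolution; apply: (@le_trans _ _ (\sum_(i < N) a i * M')).
  by apply: ler_sum => i _; rewrite ler_wpM2l// /a.
by rewrite -mulr_suml ler_wpM2r.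
Qed.

Lemma wsummable_subring_closed : subring_closed wsummable.
Proof.
split; last exact: wsummableM.
- by rewrite -(rmorph1 (@fps_of_poly K)) wsummable_poly.
- move=> u v /wsummableP[M uM] /wsummableP[M' vM']; apply/wsummableP.
  exists (M + M') => N; apply: le_trans (lerD (uM N) (vM' N)).
  rewrite -big_split /=; apply: ler_sum => i _.
  by rewrite !fpsE mulrBl ler_normB.
Qed.

HB.instance Definition _ := GRing.isSubringClosed.Build (fps K) wsummable_pred
  wsummable_subring_closed.

Lemma wsummable_geometric a : `|a * s| < 1 -> fps_geometric a \is a wsummable.
Proof.
move=> as1; apply/wsummableP; exists (1 - `|a * s|)^-1 => N.
rewrite (eq_bigr (fun i : 'I_N => `|a * s| ^+ i)).
  rewrite -div1r ler_pdivlMr ?subr_gt0// mulrC -[1 - _]opprB mulNr -subrX1 opprB.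
  by rewrite gerBl exprn_ge0.
by move=> i _; rewrite -exprMn normrX.
Qed.

Lemma wsummable_divXsubC z v : `|s| < `|z| ->
  ('X - z%:P)%:FPS * v \is a wsummable -> v \is a wsummable.
Proof.
move=> sz /wsummableP[M wM]; apply/wsummableP.
pose A N := \sum_(i < N) `|v i * s ^+ i|; pose Xv := 'X%:FPS * v.
exists (M / (`|z| - `|s|)) => N; rewrite -/(A N) ler_pdivlMr ?subr_gt0//.
have A_shift : `|s| * A N = \sum_(i < N.+1) `|Xv i * s ^+ i|.
  rewrite big_ord_recl /Xv fpsXM mul0r normr0 add0r mulr_sumr.
  by apply: eq_bigr => i _; rewrite fpsXM exprS mulrCA -normrM.
have : `|z| * A N.+1 <= M + `|s| * A N.
  apply: le_trans (lerD (wM N.+1) (lexx _)).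
  rewrite A_shift mulr_sumr -big_split /=; apply: ler_sum => i _.
  rewrite rmorphB /= mulrBl -/Xv !fpsE fpsCM mulrBl -normrM mulrA.
  by rewrite -lerBlDr distrC lerB_dist.
rewrite mulrBr lerBlDr ![A N * _]mulrC; apply: le_trans.
by rewrite ler_wpM2l// /A big_ord_recr lerDl.
Qed.

End WeightedSummability.

Lemma wsummable_divp (K : numClosedFieldType) (s : K) (q : {poly K}) (v : fps K) :
    q != 0 -> (forall z, root q z -> `|s| < `|z|) ->
  q%:FPS * v \is a wsummable s -> v \is a wsummable s.
Proof.
have [rs ->] := closed_field_poly_normal q.
set a := lead_coef q => q_neq0 q_root.
have a_neq0 : a != 0 by apply: contraNneq q_neq0 => ->; rewrite scale0r.
have {q_root} rs_gt z : z \in rs -> `|s| < `|z|.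
  by move=> z_rs; apply: q_root; rewrite rootZ// root_prod_XsubC.
move=> /(rpredM (wsummable_poly s a^-1%:P)).
rewrite mulrA -rmorphM /= -mul_polyC mulrA -polyCM mulVf// mul1r.
elim: rs {q_neq0} rs_gt => [_|z rs IH rs_gt]; first by rewrite big_nil rmorph1 mul1r.
rewrite big_cons rmorphM /= -mulrA => /wsummable_divXsubC v_sum.
apply: IH => [y y_rs|]; first by rewrite rs_gt// in_cons y_rs orbT.
by apply: v_sum; rewrite rs_gt ?mem_head.
Qed.

Section RealDivision.
Local Open Scope complex_scope.
Variable R : realType.
Implicit Types (s : R) (u v : fps R).

Lemma normcR (x : R) : `|x%:C| = `|x|%:C.
Proof. by rewrite normc_def /= expr0n /= addr0 sqrtr_sqr. Qed.

Lemma wsummable_realC s u :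
  (fps_map (real_complex R) u \is a wsummable s%:C) = (u \is a wsummable s).
Proof.
have normE N : \sum_(i < N) `|(u i)%:C * s%:C ^+ i| = (\sum_(i < N) `|u i * s ^+ i|)%:C.
  by rewrite rmorph_sum; apply: eq_bigr => i _; rewrite /= -normcR rmorphM rmorphXn.
apply/wsummableP/wsummableP => -[M uM].
  by exists (complex.Re M) => N; have := uM N; rewrite normE lecE => /andP[].
by exists M%:C => N; rewrite normE lecR.
Qed.

Lemma wsummable_divp_real s (q : {poly R}) v :
    q != 0 -> (forall z, root (map_poly (real_complex R) q) z -> `|s%:C| < `|z|) ->
  q%:FPS * v \is a wsummable s -> v \is a wsummable s.
Proof.
move=> q_neq0 q_root; rewrite -!wsummable_realC fps_mapM fps_map_poly.
by apply: wsummable_divp; rewrite ?map_poly_eq0.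
Qed.

End RealDivision.

(** * Binomial moments and tails *)

(* [binomial_moment k u] is the coefficient of [(X - 1)^k] in the Taylor expansion of
   [u] at [1], and [fps_tail u] is the quotient of [u(1) - u] by [1 - X]. *)
Definition binomial_moment (R : realType) (k : nat) (u : fps R) : R :=
  limn (series (fun n => 'C(n, k)%:R * u n)).

Definition fps_tail (R : realType) (u : fps R) : fps R :=
  fun n => binomial_moment 0 u - series u n.+1.

Section Tail.
Variable R : realType.
Implicit Types (u v : fps R) (p : {poly R}) (a : R).

Lemma fps_tailE u :
  fps_tail u = ((binomial_moment 0 u)%:P%:FPS - u) * fps_geometric 1.
Proof.
by apply/funext => n; rewrite mulrBl !fpsE fpsCM mul_geometric1 /fps_geometric expr1n mulr1.
Qed.

Lemma nabla_tail u : nabla * fps_tail u = (binomial_moment 0 u)%:P%:FPS - u.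
Proof. by rewrite fps_tailE mulrCA nabla_geometric mulr1. Qed.

Lemma fps_tail_unique u v a : v @ \oo --> (0 : R) -> nabla * v = a%:P%:FPS - u ->
  binomial_moment 0 u = a /\ fps_tail u = v.
Proof.
move=> v0 nabla_v.
have vE n : v n = a - series u n.+1.
  rewrite -[v]mul1r -nabla_geometric mulrAC nabla_v mulrBl !fpsE fpsCM mul_geometric1.
  by rewrite /fps_geometric expr1n mulr1.
have moment_u : binomial_moment 0 u = a.
  apply: (cvg_lim (@Rhausdorff R)).
  rewrite (_ : (fun n => _) = u); last by apply/funext => n; rewrite bin0 mul1r.
  rewrite -cvg_shiftS -[a]subr0; under eq_fun do rewrite -[series _ _](subKr a) -vE.
  by apply: cvgB => //; exact: cvg_cst.
by split=> //; apply/funext => n; rewrite /fps_tail moment_u -vE.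
Qed.

Lemma cvg_fps_of_poly p : p%:FPS @ \oo --> (0 : R).
Proof.
by apply: cvg_near_cst; exists (size p) => // n /= le_pn; rewrite fpsE nth_default.
Qed.

Lemma moment0_poly p : binomial_moment 0 p%:FPS = p.[1].
Proof.
have /factor_theorem[q pE] : root (p - p.[1]%:P) 1 by rewrite /root !hornerE subrr.
have [] // := @fps_tail_unique p%:FPS q%:FPS p.[1] (cvg_fps_of_poly _).
rewrite /nabla -(rmorph1 (@fps_of_poly R)) -!rmorphB -rmorphM /=; congr (_%:FPS).
by rewrite -[RHS]opprB pE polyC1; ring.
Qed.

End Tail.

Section BinomialMoments.
Variables (R : realType) (s : R).
Hypothesis s_gt1 : 1 < s.
Implicit Types (u v t h : fps R) (k n : nat).

Let s_ge0 : 0 <= s. Proof. exact: le_trans (ltW s_gt1). Qed.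

Lemma bin_le_expn k n : 'C(n, k)%:R <= (s - 1) ^- k * s ^+ n.
Proof.
have s1_gt0 : 0 < s - 1 by rewrite subr_gt0.
rewrite mulrC ler_pdivlMr ?exprn_gt0//.
have [lt_nk|le_kn] := ltnP n k; first by rewrite bin_small// mul0r exprn_ge0.
rewrite -[in leRHS](subrKC 1 s) [leRHS]exprDn (bigD1 (Ordinal (le_kn : (k < n.+1)%N)))//=.
rewrite expr1n mul1r mulr_natl lerDl sumr_ge0// => i _.
by rewrite expr1n mul1r mulrn_wge0// exprn_ge0// ltW.
Qed.

Lemma wsummable_cvg_series u : u \is a wsummable s ->
  cvgn (series (fun n => `|u n * s ^+ n|)).
Proof.
move=> /wsummableP[M uM]; apply: nondecreasing_is_cvgn.
  by apply: nondecreasing_series => n _ _; exact: normr_ge0.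
by exists M => _ [N _ <-]; rewrite seriesEord; exact: uM.
Qed.

Lemma cvg_binomial_moment k u : u \is a wsummable s ->
  series (fun n => 'C(n, k)%:R * u n) @ \oo --> binomial_moment k u.
Proof.
move=> u_sum; apply: normed_cvg.
apply: (series_le_cvg (v_ := (s - 1) ^- k *: (fun n => `|u n * s ^+ n|))) => [n|n|n|].
- exact: normr_ge0.
- by rewrite mulr_ge0// invr_ge0 exprn_ge0// subr_ge0 ltW.
- rewrite -[leRHS]/((s - 1) ^- k * `|u n * s ^+ n|) /= !normrM normr_nat mulrCA.
  rewrite (ger0_norm (_ : 0 <= s ^+ n)) ?exprn_ge0//.
  by rewrite [leLHS]mulrC ler_wpM2l// bin_le_expn.
apply: is_cvg_seriesZ; exact: wsummable_cvg_series.
Qed.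

Lemma cvg_series_moment0 u : u \is a wsummable s ->
  series u @ \oo --> binomial_moment 0 u.
Proof.
move=> /(@cvg_binomial_moment 0); rewrite (_ : (fun n => _) = u)//.
by apply/funext => n; rewrite bin0 mul1r.
Qed.

Lemma wsummable_cvg0 u : u \is a wsummable s -> u @ \oo --> (0 : R).
Proof.
move=> /cvg_series_moment0 u_cvg.
by apply: cvg_series_cvg_0; apply/cvg_ex; exists (binomial_moment 0 u).
Qed.

Lemma norm_fps_tail_le u M N : (forall n, \sum_(i < n) `|u i * s ^+ i| <= M) ->
  `|fps_tail u N * s ^+ N| <= M.
Proof.
move=> uM; have u_sum : u \is a wsummable s by apply/wsummableP; exists M.
have tail_lim : (fun J => `|(series u J - series u N.+1) * s ^+ N|) @ \oo -->
    `|fps_tail u N * s ^+ N|.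
  apply: cvg_norm; apply: cvgMl; apply: cvgB; first exact: cvg_series_moment0.
  exact: cvg_cst.
apply: (cvgr_to_le tail_lim); exists N.+1 => // J /= lt_NJ.
rewrite sub_series lt_NJ mulr_suml; apply: le_trans (ler_norm_sum _ _ _) _.
apply: le_trans (uM J); rewrite -(big_mkord xpredT (fun i => `|u i * s ^+ i|)).
rewrite [leRHS](big_cat_nat (leq0n N.+1) lt_NJ) /= -[leLHS]add0r lerD ?sumr_ge0//.
apply: ler_sum_nat => k /andP[lt_Nk _]; rewrite !normrM ler_wpM2l//.
by rewrite !ger0_norm ?exprn_ge0// ler_weXn2l ?(ltW s_gt1) ?(ltnW lt_Nk).
Qed.

Lemma wsummable_tail u : u \is a wsummable s -> fps_tail u \is a wsummable s.
Proof.
move=> /wsummableP[M uM]; set v := fps_tail u.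
pose A N := \sum_(i < N) `|v i * s ^+ i|.
have v_step i : `|v i * s ^+ i.+1| <= `|v i.+1 * s ^+ i.+1| + `|u i.+1 * s ^+ i.+1|.
  have -> : v i = v i.+1 + u i.+1 by rewrite /v /fps_tail (seriesSr u i.+1); ring.
  by rewrite mulrDl ler_normD.
have A_step N : s * A N <= A N.+1 + M.
  apply: (@le_trans _ _ (\sum_(i < N) (`|v i.+1 * s ^+ i.+1| + `|u i.+1 * s ^+ i.+1|))).
    rewrite mulr_sumr; apply: ler_sum => i _; apply: le_trans (v_step i).
    by rewrite exprS mulrCA [leRHS]normrM ger0_norm.
  rewrite big_split lerD//; first by rewrite /A big_ord_recl /= lerDr.
  by apply: le_trans (uM N.+1); rewrite big_ord_recl /= lerDr.
apply/wsummableP; exists ((M + M) / (s - 1)) => N; rewrite -/(A N).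
rewrite ler_pdivlMr ?subr_gt0// mulrBr mulr1 lerBlDr mulrC; apply: le_trans (A_step N) _.
by rewrite /A big_ord_recr /=; have := norm_fps_tail_le N uM; rewrite -/v; lra.
Qed.

Lemma moment_tail k u : u \is a wsummable s ->
  binomial_moment k (fps_tail u) = binomial_moment k.+1 u.
Proof.
move=> u_sum; have tail_sum := wsummable_tail u_sum.
have summation_by_parts N : series (fun n => 'C(n, k)%:R * fps_tail u n) N =
    'C(N, k.+1)%:R * fps_tail u N + series (fun n => 'C(n, k.+1)%:R * u n) N.+1.
  elim: N => [|N IH].
    by rewrite /series /= big_nil big_nat1 bin0n !mul0r addr0.
  rewrite seriesSr IH [in RHS]seriesSr binS natrD.
  have -> : u N.+1 = fps_tail u N - fps_tail u N.+1.
    by rewrite /fps_tail (seriesSr u N.+1); ring.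
  ring.
have boundary0 : (fun N => 'C(N, k.+1)%:R * fps_tail u N) @ \oo --> (0 : R).
  apply: cvg_series_cvg_0; apply/cvg_ex; exists (binomial_moment k.+1 (fps_tail u)).
  exact: cvg_binomial_moment.
apply: (cvg_lim (@Rhausdorff R)).
rewrite (funext summation_by_parts) -[binomial_moment _ _]add0r.
by apply: cvgD => //; rewrite (cvg_shiftS (series _)); exact: cvg_binomial_moment.
Qed.

Lemma momentD k u v : u \is a wsummable s -> v \is a wsummable s ->
  binomial_moment k (u + v) = binomial_moment k u + binomial_moment k v.
Proof.
move=> u_sum v_sum; apply: (cvg_lim (@Rhausdorff R)).
rewrite (_ : series _ = series (fun n => 'C(n, k)%:R * u n) +
    series (fun n => 'C(n, k)%:R * v n)).
  by apply: cvgD; exact: cvg_binomial_moment.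
by rewrite -seriesD; congr series; apply/funext => n; rewrite fpsE mulrDr.
Qed.

Lemma momentB k u v : u \is a wsummable s -> v \is a wsummable s ->
  binomial_moment k (u - v) = binomial_moment k u - binomial_moment k v.
Proof. by move=> u_sum v_sum; rewrite -{2}(subrK v u) [in RHS]momentD ?rpredB// addrK. Qed.

Lemma second_moment u : u \is a wsummable s ->
  limn (series (fun n => n%:R ^+ 2 * u n)) = binomial_moment 2 u *+ 2 + binomial_moment 1 u.
Proof.
move=> u_sum; have sqrE n : n%:R ^+ 2 = 2 * 'C(n, 2)%:R + 'C(n, 1)%:R :> R.
  by rewrite -natrX -natrM -natrD bin1; congr (_%:R); elim: n => // n; rewrite binS bin1; lia.
apply: (cvg_lim (@Rhausdorff R)); rewrite -mulr_natl.
rewrite (_ : series _ = 2 *: series (fun n => 'C(n, 2)%:R * u n) +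
    series (fun n => 'C(n, 1)%:R * u n)).
  by apply: cvgD; [apply: cvgZr|]; exact: cvg_binomial_moment.
rewrite -seriesZ -seriesD; congr series; apply/funext => n.
by rewrite sqrE mulrDl -mulrA.
Qed.

Lemma moment0M_tailM u v : u \is a wsummable s -> v \is a wsummable s ->
  binomial_moment 0 (u * v) = binomial_moment 0 u * binomial_moment 0 v /\
  fps_tail (u * v) = fps_tail u * v + (binomial_moment 0 u)%:P%:FPS * fps_tail v.
Proof.
move=> u_sum v_sum; apply: fps_tail_unique.
  by apply: wsummable_cvg0; rewrite rpredD ?rpredM ?wsummable_poly ?wsummable_tail.
rewrite mulrDr mulrA nabla_tail mulrCA nabla_tail polyCM rmorphM /=; ring.
Qed.

Lemma moment0M u v : u \is a wsummable s -> v \is a wsummable s ->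
  binomial_moment 0 (u * v) = binomial_moment 0 u * binomial_moment 0 v.
Proof. by move=> u_sum v_sum; have [] := moment0M_tailM u_sum v_sum. Qed.

Lemma moment1M u v : u \is a wsummable s -> v \is a wsummable s ->
  binomial_moment 1 (u * v) =
  binomial_moment 1 u * binomial_moment 0 v + binomial_moment 0 u * binomial_moment 1 v.
Proof.
move=> u_sum v_sum; have [_ tailM] := moment0M_tailM u_sum v_sum.
rewrite -moment_tail ?rpredM// tailM.
have tailu_sum := wsummable_tail u_sum; have tailv_sum := wsummable_tail v_sum.
rewrite momentD ?rpredM ?wsummable_poly// !moment0M ?wsummable_poly// moment0_poly hornerC.
by rewrite !moment_tail.
Qed.

Lemma moment0_inv t h : t \is a wsummable s -> h \is a wsummable s -> t * h = 1 ->
  binomial_moment 0 t * binomial_moment 0 h = 1.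
Proof.
move=> t_sum h_sum th1.
by rewrite -moment0M// th1 -(rmorph1 (@fps_of_poly R)) moment0_poly hornerC.
Qed.

Lemma moment1_inv t h : t \is a wsummable s -> h \is a wsummable s -> t * h = 1 ->
  binomial_moment 1 h = - binomial_moment 1 t * binomial_moment 0 h ^+ 2.
Proof.
move=> t_sum h_sum th1.
have moment1_1 : binomial_moment 1 (1 : fps R) = 0.
  have /= := @moment1M 1 1 (rpred1 _) (rpred1 _).
  rewrite mulr1 -(rmorph1 (@fps_of_poly R)) moment0_poly hornerC; lra.
have := moment1M t_sum h_sum; rewrite th1 moment1_1.
have := moment0_inv t_sum h_sum th1.
set t0 := binomial_moment 0 t; set h0 := binomial_moment 0 h.
set t1 := binomial_moment 1 t; set h1 := binomial_moment 1 h => t0h0 leibniz.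
transitivity ((t0 * h0) * h1); first by rewrite t0h0 mul1r.
by rewrite -mulrA (mulrC h0) mulrA (_ : t0 * h1 = - t1 * h0) 1?expr2 ?mulrA//; lra.
Qed.

Lemma moment_gt0 k n u : u \is a wsummable s -> (forall i, 0 <= u i) ->
  (k <= n)%N -> 0 < u n -> 0 < binomial_moment k u.
Proof.
move=> u_sum u_ge0 le_kn un_gt0.
apply: (@lt_le_trans _ _ ('C(n, k)%:R * u n)); first by rewrite mulr_gt0// ltr0n bin_gt0.
apply: (@le_trans _ _ (series (fun n => 'C(n, k)%:R * u n) n.+1)).
  by rewrite seriesSr lerDr /series /= sumr_ge0// => i _; rewrite mulr_ge0.
apply: nondecreasing_cvgn_le.
  by apply: nondecreasing_series => i _ _; rewrite mulr_ge0.
by apply/cvg_ex; exists (binomial_moment k u); exact: cvg_binomial_moment.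
Qed.

Lemma wsummable_bigO u : u \is a wsummable s -> u =O_\oo (fun n => s^-1 ^+ n : R).
Proof.
move=> /wsummableP[M uM]; apply/eqOP; near=> B; apply: nearW => n.
have s_gt0 : 0 < s ^+ n by rewrite exprn_gt0// (lt_trans ltr01).
rewrite exprVn normfV (gtr0_norm s_gt0) ler_pdivlMr// -{1}(gtr0_norm s_gt0) -normrM.
apply: (@le_trans _ _ M); last by near: B; apply: nbhs_pinfty_ge; exact: num_real.
by apply: le_trans (uM n.+1); rewrite big_ord_recr /= lerDr sumr_ge0.
Unshelve. all: by end_near. Qed.

End BinomialMoments.

(** * Asymptotics of renewal equations *)

Section BigO.
Variable R : realType.
Implicit Types (f g h k : nat -> R).

Lemma eqO_mul f g h k : f =O_\oo h -> g =O_\oo k -> f * g =O_\oo (h * k).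
Proof. by move=> -> ->; exact: (@mulO R nat). Qed.

Lemma cvg_eqO1 f (l : R) : f @ \oo --> l -> f =O_\oo (1 : nat -> R).
Proof.
move=> /cvg_bounded f_bounded; apply/eqOP; near=> M.
have : \forall n \near \oo, `|f n| <= M by near: M.
by apply: filterS => n; rewrite normr1 mulr1.
Unshelve. all: by end_near. Qed.

Lemma affine_eqO (a b : R) : (fun n => a * n%:R + b) =O_\oo (fun n => n%:R : R).
Proof.
apply/eqOP; near=> B; near=> n; have n_ge1 : 1 <= n%:R :> R.
  by rewrite ler1n; near: n; exists 1%N.
apply: (@le_trans _ _ ((`|a| + `|b|) * `|n%:R|)).
  apply: le_trans (ler_normD _ _) _; rewrite mulrDl normrM lerD2l normr_nat.
  by rewrite ler_peMr.
by rewrite ler_wpM2r//; near: B; apply: nbhs_pinfty_ge; exact: num_real.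
Unshelve. all: by end_near. Qed.

Lemma ratio_eqaddO (a1 a0 m : R) (b c w e rho : nat -> R) : m != 0 ->
    (forall n, b n = (a1 * n%:R + a0) * m + w n) -> (forall n, c n = m + e n) ->
    w =O_\oo rho -> e =O_\oo rho -> e @ \oo --> (0 : R) ->
  (fun n => b n / c n) = (fun n => a1 * n%:R + a0) +O_\oo (fun n => n%:R * rho n : R).
Proof.
move=> m_neq0 bE cE w_O e_O e_lim; pose A n : R := a1 * n%:R + a0.
have c_lim : c @ \oo --> m.
  by rewrite (funext cE) -[X in _ --> X]addr0; apply: cvgD => //; exact: cvg_cst.
pose c_inv : nat -> R := fun n => (c n)^-1.
have c_inv_O : c_inv =O_\oo (1 : nat -> R).
  by apply: cvg_eqO1; apply: cvgV c_lim.
have : ((w - A * e) * c_inv : nat -> R) =O_\oo ((fun n => n%:R : R) * rho).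
  rewrite -[X in _ =O_\oo X]mulr1; apply: eqO_mul c_inv_O; apply: add2O.
    rewrite (_ : w = (fun n => 0 * n%:R + 1) * w).
      by apply: eqO_mul w_O; exact: affine_eqO.
    by apply/funext => n /=; rewrite -[RHS]/((_ + _) * w n) mul0r add0r mul1r.
  by apply: oppfO => //; apply: eqO_mul e_O; exact: affine_eqO.
move/eqOP => diff_O; apply/eqaddOP; move: diff_O; apply: filterS => K.
have : \forall n \near \oo, c n != 0 by apply: (cvgr_neq0 _ c_lim).
apply: filterS2 => n cn_neq0.
suff -> : ((fun n => b n / c n) - A) n = ((w - A * e) * c_inv) n by [].
rewrite -[LHS]/(b n / c n - A n) -[RHS]/((w n - A n * e n) / c n).
by apply: (mulIf cn_neq0); rewrite mulrBl !divfK// bE cE /A; ring.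
Qed.

End BigO.

Section Renewal.
Variables (R : realType) (s : R).
Hypothesis s_gt1 : 1 < s.
Implicit Types (u b c : fps R).

Local Notation moment := binomial_moment.

Lemma nabla_pole1 u c n : nabla * c = u -> c n = moment 0 u - fps_tail u n.
Proof.
move=> <-; rewrite /fps_tail subKr -mul_geometric1.
by rewrite mulrAC nabla_geometric mul1r.
Qed.

Lemma nabla_pole2 u b n : u \is a wsummable s -> nabla * (nabla * b) = u ->
  b n = moment 0 u * n.+1%:R - moment 1 u + fps_tail (fps_tail u) n.
Proof.
move=> u_sum nabla2_b; pose cst a : fps R := a%:P%:FPS; pose g : fps R := fps_geometric 1.
have nabla_g : nabla * g = 1 := nabla_geometric R.
have -> : b = cst (moment 0 u) * (g * g) - cst (moment 1 u) * g + fps_tail (fps_tail u).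
  apply: nabla_inj; apply: nabla_inj; rewrite nabla2_b.
  rewrite [in RHS]mulrDr nabla_tail (moment_tail s_gt1)// -/(cst _).
  transitivity (cst (moment 0 u) * (nabla * g) ^+ 2 -
    cst (moment 1 u) * nabla * (nabla * g - 1) - nabla * fps_tail u); last by ring.
  by rewrite nabla_g nabla_tail /cst; ring.
by rewrite !fpsE !fpsCM fps_geometric_sqr /g /fps_geometric !expr1n mulr1.
Qed.

Variables (sigma l b c h : fps R).
Hypothesis sigma_sum : sigma \is a wsummable s.
Hypothesis l_sum : l \is a wsummable s.
Hypothesis h_sum : h \is a wsummable s.
Hypothesis nabla_c : nabla * c = h.
Hypothesis sigma_total : moment 0 sigma = 1.
Hypothesis count_eq : (1 - sigma) * c = 1.
Hypothesis total_eq : (1 - sigma) * b = l * c.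

Local Notation m := (moment 1 sigma).

Lemma tail_renewal_inv : fps_tail sigma * h = 1.
Proof. by rewrite -nabla_c mulrCA mulrA nabla_tail sigma_total rmorph1. Qed.

Lemma renewal_mean_neq0 : m != 0.
Proof.
have := moment0_inv s_gt1 (wsummable_tail s_gt1 sigma_sum) h_sum tail_renewal_inv.
rewrite (moment_tail s_gt1)// => /eqP; apply: contraTneq => ->.
by rewrite mul0r eq_sym oner_eq0.
Qed.

Lemma moment0_renewal : moment 0 h = m^-1.
Proof.
apply: (mulfI renewal_mean_neq0); rewrite mulfV ?renewal_mean_neq0// -(moment_tail s_gt1)//.
exact: (moment0_inv s_gt1 (wsummable_tail s_gt1 sigma_sum) h_sum tail_renewal_inv).
Qed.

Lemma moment1_renewal : moment 1 h = - (moment 2 sigma / m ^+ 2).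
Proof.
rewrite (moment1_inv s_gt1 (wsummable_tail s_gt1 sigma_sum) h_sum tail_renewal_inv).
by rewrite (moment_tail s_gt1)// moment0_renewal exprVn mulNr.
Qed.

Lemma renewal_count n : c n = m^-1 - fps_tail h n.
Proof. by rewrite -moment0_renewal; exact: nabla_pole1. Qed.

Local Notation numerator := (l * h ^+ 2).

Lemma renewal_total n : b n = moment 0 l / m ^+ 2 * n.+1%:R -
  (moment 1 l / m ^+ 2 - moment 0 l * moment 2 sigma *+ 2 / m ^+ 3) +
  fps_tail (fps_tail numerator) n.
Proof.
have -> : moment 0 l / m ^+ 2 = moment 0 numerator.
  by rewrite !(moment0M s_gt1) ?rpredM// moment0_renewal expr2 invfM.
have -> : moment 1 l / m ^+ 2 - moment 0 l * moment 2 sigma *+ 2 / m ^+ 3 =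
    moment 1 numerator.
  rewrite !(moment1M s_gt1) ?rpredM// (moment0M s_gt1)// moment0_renewal.
  by rewrite moment1_renewal; field; exact: renewal_mean_neq0.
apply: nabla_pole2; first by rewrite rpredM ?rpredX.
transitivity (fps_tail sigma * h * (nabla * (nabla * b))).
  by rewrite tail_renewal_inv mul1r.
transitivity ((nabla * fps_tail sigma) * b * (nabla * h)); first by ring.
by rewrite nabla_tail sigma_total rmorph1 total_eq -nabla_c; ring.
Qed.

Lemma renewal_ratio :
  (fun n => b n / c n) =
  (fun n => moment 0 l / m * n%:R +
    (moment 0 l * (moment 2 sigma *+ 2 + m) / m ^+ 2 - moment 1 l / m))
  +O_\oo (fun n => n%:R * s^-1 ^+ n : R).
Proof.
have m_neq0 := renewal_mean_neq0.
have tail_h_sum : - fps_tail h \is a wsummable s by rewrite rpredN wsummable_tail.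
apply: (@ratio_eqaddO _ _ _ m^-1 b c (fps_tail (fps_tail numerator)) (- fps_tail h)).
- by rewrite invr_eq0.
- by move=> n; rewrite renewal_total -natr1; field.
- exact: renewal_count.
- by apply: (wsummable_bigO s_gt1); rewrite !(wsummable_tail s_gt1) ?rpredM ?rpredX.
- exact: (wsummable_bigO s_gt1).
- exact: (wsummable_cvg0 s_gt1).
Qed.

End Renewal.

(** * Generating functions of restricted compositions *)

Section Compositions.
Variable S : set nat.
Hypothesis S_pos : S `<=` positive_integers.
Implicit Types (n k : nat) (l : seq nat).

Let mem_fset_compositions n l :
  (l \in fset_set (compositions S n)) = (l \in compositions S n).
Proof. by rewrite in_fset_set//; exact: finite_compositions. Qed.

Lemma zero_notin_parts : (0%N \in S) = false.
Proof. by apply/negbTE/negP => /set_mem /S_pos. Qed.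

Lemma compositions0 : compositions S 0 = [set [::]].
Proof.
apply/seteqP; split=> [[|k l] [lS]|_ ->]//= /eqP.
by rewrite addn_eq0 => /andP[/eqP k0 _]; have /S_pos := lS k (mem_head _ _); rewrite k0.
Qed.

Lemma compositions_cons n k l :
  compositions S n (k :: l) <-> [/\ S k, (k <= n)%N & compositions S (n - k) l].
Proof.
split=> [[lS /= <-]|[Sk le_kn [lS l_sum]]]; last first.
  split; last by rewrite /= l_sum subnKC.
  by move=> j; rewrite in_cons => /predU1P[->//|/lS].
rewrite leq_addr addKn; split=> //; first by apply: lS; rewrite mem_head.
by split=> // j jl; apply: lS; rewrite in_cons jl orbT.
Qed.

Lemma sum_compositions_cons (V : nmodType) (Y : nat -> seq nat -> V) n :
  \sum_(l \in compositions S n) (if l is k :: l' then Y k l' else 0) =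
  \sum_(k < n.+1 | (k : nat) \in S) \sum_(l \in compositions S (n - k)) Y k l.
Proof.
pose parts := [seq k <- iota 0 n.+1 | k \in S].
pose comps k : seq (seq nat) := fset_set (compositions S (n - k)).
rewrite fsbig_finite; last exact: finite_compositions.
rewrite (bigID (@nilp nat)) /= big1 ?add0r => [|[]//]; rewrite -big_filter.
rewrite (perm_big [seq k :: l | k <- parts, l <- comps k]); last first.
  apply: uniq_perm; first by rewrite filter_uniq ?fset_uniq.
    apply: allpairs_uniq_dep => [|k _|[k l] [k' l'] _ _ /= [-> ->]//].
      by rewrite filter_uniq ?iota_uniq.
    exact: fset_uniq.
  move=> l; rewrite mem_filter mem_fset_compositions; apply/andP/allpairsPdep.
    case: l => [[]//|k l [_ /set_mem/compositions_cons[kS le_kn l_comp]]].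
    exists k, l; rewrite mem_filter mem_iota add0n ltnS le_kn /= andbT.
    by rewrite mem_fset_compositions; split=> //; exact: mem_set.
  move=> [k [l' [+ + ->]]]; rewrite mem_filter mem_iota add0n ltnS mem_fset_compositions.
  move=> /andP[/set_mem kS le_kn] /set_mem l'_comp.
  by split=> //; apply/mem_set/compositions_cons.
rewrite big_allpairs_dep big_filter -(big_mkord (fun k => k \in S)
  (fun k => \sum_(l \in compositions S (n - k)) Y k l)) /index_iota subn0.
by apply: eq_bigr => k _; rewrite fsbig_finite//; exact: finite_compositions.
Qed.

Variables (K : comNzRingType) (x : K).
Implicit Types (f w : nat -> K) (X Y : seq nat -> K).

Definition part_gf w : fps K := fun k => if k \in S then w k * x ^+ k else 0.

Definition comp_gf X : fps K := fun n => (\sum_(l \in compositions S n) X l) * x ^+ n.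

Definition part_sum w (l : seq nat) : K := \sum_(k <- l) w k.

Lemma part_gfM f Y :
  part_gf f * comp_gf Y = comp_gf (fun l => if l is k :: l' then f k * Y l' else 0).
Proof.
apply/funext => n; rewrite fpsM [RHS]/comp_gf (sum_compositions_cons (fun k l => f k * Y l)).
rewrite mulr_suml [RHS]big_mkcond; apply: eq_bigr => k _.
rewrite /part_gf /comp_gf; case: ifP => _; last by rewrite mul0r.
rewrite !fsbig_finite; try exact: finite_compositions.
by rewrite -mulr_sumr mulrACA -exprD subnKC// -ltnS.
Qed.

Lemma comp_gfD X Y : comp_gf (fun l => X l + Y l) = comp_gf X + comp_gf Y.
Proof.
apply/funext => n.
by rewrite fpsE /comp_gf -mulrDl -fsbig_split//; exact: finite_compositions.
Qed.

Lemma comp_gf_nil : comp_gf (fun l => (l == [::])%:R) = 1.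
Proof.
apply/funext => -[|n]; rewrite fps1 /comp_gf; last first.
  by rewrite fsbig1 ?mul0r// => -[|k l] [].
by rewrite compositions0 fsbig_set1 mulr1.
Qed.

Lemma count_renewal : (1 - part_gf (fun=> 1)) * comp_gf (fun=> 1) = 1.
Proof.
rewrite mulrBl mul1r part_gfM -comp_gf_nil; apply/eqP; rewrite subr_eq -comp_gfD; apply/eqP.
by congr comp_gf; apply/funext => -[|k l]; rewrite ?addr0 ?add0r ?mulr1.
Qed.

Lemma part_sum_renewal w :
  (1 - part_gf (fun=> 1)) * comp_gf (part_sum w) = part_gf w * comp_gf (fun=> 1).
Proof.
rewrite mulrBl mul1r !part_gfM; apply/eqP; rewrite subr_eq -comp_gfD; apply/eqP.
congr comp_gf; apply/funext => -[|k l]; rewrite /part_sum ?big_nil ?addr0//.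
by rewrite big_cons mulr1 mul1r.
Qed.

End Compositions.

Lemma ln_nat_itv (R : realType) k : 0 <= (ln k%:R : R) <= k.+1%:R.
Proof.
case: k => [|k]; first by rewrite ln0 ?lexx ?ler01.
rewrite ln_ge0 ?ler1n//=; apply: (@le_trans _ _ k.+1%:R); last by rewrite ler_nat.
by rewrite ltW// ln_sublinear.
Qed.

Section Expectation.
Variables (R : realType) (S : set nat).
Hypothesis S_pos : S `<=` positive_integers.

Lemma expectation_part_sum (x : R) (w : nat -> R) n : x != 0 ->
  uniform_expectation (compositions S n) (part_sum w) =
  comp_gf S x (part_sum w) n / comp_gf S x (fun=> 1) n.
Proof.
move=> x_neq0; rewrite /uniform_expectation /comp_gf -mulf_div divff ?expf_neq0// mulr1.
congr (_ / _); rewrite fsbig_finite; last exact: finite_compositions.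
by rewrite card_fset_sum1 natr_sum.
Qed.

Lemma ln_part_product n l : compositions S n l ->
  ln (part_product l)%:R = part_sum (fun k => ln k%:R : R) l.
Proof.
move=> [lS _]; have : forall k, k \in l -> (0 < k)%N by move=> k /lS/S_pos.
rewrite /part_product /part_sum.
elim: l {lS} => [|k l IH] l_gt0; first by rewrite !big_nil ln1.
have tail_gt0 j : j \in l -> (0 < j)%N by move=> jl; rewrite l_gt0// in_cons jl orbT.
rewrite !big_cons natrM lnM ?IH// posrE ltr0n; first by rewrite l_gt0 ?mem_head.
by rewrite big_seq prodn_cond_gt0.
Qed.

Lemma expectation_ln_part_product n :
  uniform_expectation (compositions S n) (fun l => ln (part_product l)%:R : R) =
  uniform_expectation (compositions S n) (part_sum (fun k => ln k%:R)).
Proof.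
by congr (_ / _); apply: eq_fsbigr => l /set_mem; exact: ln_part_product.
Qed.

End Expectation.

Lemma normr1_le_natS (K : numDomainType) k : `|1 : K| <= k.+1%:R.
Proof. by rewrite normr1 ler1n. Qed.

Section PartSummability.
Variable S : set nat.

Lemma wsummable_part_gf (K : numFieldType) (x s : K) (w : nat -> K) :
    (forall k, `|w k| <= k.+1%:R) -> `|x * s| < 1 ->
  part_gf S x w \is a wsummable s.
Proof.
move=> w_le xs1; have geo_sum := wsummable_geometric xs1.
apply: (le_wsummable _ (rpredM geo_sum geo_sum)) => k.
rewrite fps_geometric_sqr /part_gf normrMn -mulr_natl; case: ifP => _; last first.
  by rewrite normr0 mulr_ge0.
by rewrite normrM ler_wpM2r.
Qed.

Variable R : realType.
Implicit Types (x : R) (w : nat -> R).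

Lemma series_over_part_gf (u w : nat -> R) x :
  series_over S (fun k => u k * (w k * x ^+ k)) =
  limn (series (fun k => u k * part_gf S x w k)).
Proof.
congr (limn _); apply/funext => n; rewrite /series /= big_mkcond.
by apply: eq_bigr => k _; rewrite /part_gf; case: ifP; rewrite ?mulr0.
Qed.

Lemma moment0_part_gf x w :
  binomial_moment 0 (part_gf S x w) = series_over S (fun k => w k * x ^+ k).
Proof.
rewrite /binomial_moment -(series_over_part_gf (fun k => 'C(k, 0)%:R)).
by congr series_over; apply/funext => k; rewrite bin0 mul1r.
Qed.

Lemma moment1_part_gf x w :
  binomial_moment 1 (part_gf S x w) = series_over S (fun k => k%:R * w k * x ^+ k).
Proof.
rewrite /binomial_moment -(series_over_part_gf (fun k => 'C(k, 1)%:R)).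
by congr series_over; apply/funext => k; rewrite bin1 mulrA.
Qed.

Lemma part_gf_summable x w : (forall k, `|w k| <= k.+1%:R) -> `|x| < 1 ->
  exists2 s, 1 < s & part_gf S x w \is a wsummable s.
Proof.
move=> w_le x1; have x0 : 0 <= `|x| := normr_ge0 x.
exists (2 / (1 + `|x|)); first by rewrite ltr_pdivlMr; lra.
apply: wsummable_part_gf => //; rewrite normrM.
rewrite (ger0_norm (_ : 0 <= 2 / (1 + `|x|))) ?divr_ge0 ?addr_ge0//.
by rewrite mulrA ltr_pdivrMr; lra.
Qed.

Lemma part_gf_moment_gt0 j k x w : 0 < x < 1 -> (forall i, 0 <= w i <= i.+1%:R) ->
  k \in S -> (j <= k)%N -> 0 < w k -> 0 < binomial_moment j (part_gf S x w).
Proof.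
move=> /andP[x0 x1] w_itv kS le_jk wk_gt0.
have [||s s_gt1 gf_sum] := @part_gf_summable x w.
- by move=> i; have /andP[w0 w_le] := w_itv i; rewrite ger0_norm.
- by rewrite gtr0_norm.
apply: (moment_gt0 s_gt1 gf_sum _ le_jk); last by rewrite /part_gf kS mulr_gt0// exprn_gt0.
move=> i; rewrite /part_gf; case: ifP => // _.
by have /andP[w0 _] := w_itv i; rewrite mulr_ge0// exprn_ge0// ltW.
Qed.

End PartSummability.

(** * Location of the roots *)

Definition gap_poly (K : comNzRingType) (S : set nat) : {poly K} :=
  (1 - 'X) - ('X - (1 - 'X) * \sum_(t \in gaps S) ('X^t : {poly K})).

Lemma map_gap_poly (K L : comNzRingType) (f : {rmorphism K -> L}) (S : set nat) :
  finite_set (gaps S) -> map_poly f (gap_poly K S) = gap_poly L S.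
Proof.
move=> finS; rewrite /gap_poly !fsbig_finite// !(rmorphB, rmorphM, rmorph1) /= map_polyX.
rewrite rmorph_sum /=; congr (_ - (_ - _ * _)).
by apply: eq_bigr => t _; rewrite map_polyXn.
Qed.

Section GapPoly.
Variable S : set nat.
Hypotheses (S_pos : S `<=` positive_integers) (gaps_fin : finite_set (gaps S)).

Lemma cofinite_eventually : exists N, forall k, (N < k)%N -> k \in S.
Proof.
exists (\max_(t <- fset_set (gaps S)) t) => k lt_Nk.
rewrite -[_ \in _]negbK; apply/negP => kNS.
move: (lt_Nk); rewrite ltnNge => /negP; apply; apply: (@leq_bigmax_seq _ _ xpredT id) => //.
by rewrite in_fset_set// in_setD kNS andbT; apply/mem_set; exact: leq_ltn_trans lt_Nk.
Qed.

Lemma coef_gap_sum (K : comNzRingType) (x : K) n :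
  (\sum_(t \in gaps S) (x *: 'X) ^+ t)`_n = if n \in gaps S then x ^+ n else 0.
Proof.
rewrite fsbig_finite// coef_sum -(in_fset_set gaps_fin).
rewrite (eq_bigr (fun t => if t == n then x ^+ n else 0)) => [|t _]; last first.
  by rewrite exprZn coefZ coefXn eq_sym; case: eqP => [->|]; rewrite ?mulr1 ?mulr0.
rewrite -big_mkcond; case: ifPn => [n_gap|n_notgap].
  exact: (@fbig_pred1_inj _ _ _ _ _ (fun=> x ^+ n) id).
by rewrite big_seq_cond big1// => t /andP[t_gap /eqP tn]; rewrite -tn t_gap in n_notgap.
Qed.

Lemma part_gf_gap_poly (K : comNzRingType) (x : K) :
  (1 - (x *: 'X)%:FPS) * (1 - part_gf S x (fun=> 1)) = (gap_poly K S \Po (x *: 'X))%:FPS.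
Proof.
pose gam : {poly K} := \sum_(t \in gaps S) (x *: 'X) ^+ t.
have part_gfE : part_gf S x (fun=> 1) = fps_geometric x - 1 - gam%:FPS.
  apply/funext => n; rewrite !fpsE fps1 coef_gap_sum /fps_geometric /part_gf mul1r in_setD.
  have -> : (n \in positive_integers) = (0 < n)%N by apply/idP/idP => [/set_mem|/mem_set].
  case: n => [|n] /=; first by rewrite zero_notin_parts// expr0 subrr subr0.
  by rewrite subr0; case: (n.+1 \in S); rewrite /= ?subrr ?subr0.
have -> : gap_poly K S \Po (x *: 'X) = 1 - x *: 'X - (x *: 'X - (1 - x *: 'X) * gam).
  rewrite /gap_poly /gam !fsbig_finite// !(rmorphB, rmorphM, rmorph1) /= comp_polyX.
  by rewrite rmorph_sum /=; under [in RHS]eq_bigr do rewrite -comp_Xn_poly.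
rewrite part_gfE !(rmorphB, rmorphM, rmorph1) /=.
have := fps_geometricP x; set g := fps_geometric x => g_inv.
transitivity ((1 - (x *: 'X)%:FPS) * (1 + 1 + gam%:FPS) - (1 - (x *: 'X)%:FPS) * g).
  by ring.
by rewrite g_inv; ring.
Qed.

End GapPoly.

Section RootLocation.
Local Open Scope complex_scope.
Variables (R : realType) (S : set nat).
Hypotheses (S_pos : S `<=` positive_integers) (gaps_fin : finite_set (gaps S)).
Implicit Types (x p : R).

Local Notation sigma x := (part_gf S x (fun=> 1)).

Lemma f_root_realC x : f_root S x%:C <-> root (gap_poly R S) x.
Proof. by rewrite -(fmorph_root (real_complex R)) map_gap_poly. Qed.

Lemma horner_gap_poly x : `|x| < 1 ->
  (gap_poly R S).[x] = (1 - x) * (1 - binomial_moment 0 (sigma x)).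
Proof.
move=> x1; have [s s_gt1 sigma_sum] := part_gf_summable S (normr1_le_natS R) x1.
have := congr1 (binomial_moment 0) (part_gf_gap_poly S_pos gaps_fin x).
rewrite -(rmorph1 (@fps_of_poly R)) -rmorphB.
rewrite (moment0M s_gt1) ?rpredB ?wsummable_poly// (momentB s_gt1) ?wsummable_poly//.
by rewrite !moment0_poly horner_comp !hornerE => <-.
Qed.

Lemma root_gap_poly x : `|x| < 1 ->
  root (gap_poly R S) x = (binomial_moment 0 (sigma x) == 1).
Proof.
move=> x1; have x_neq1 : x != 1 by apply: contraTneq x1 => ->; rewrite normr1 ltxx.
by rewrite rootE horner_gap_poly// mulf_eq0 !subr_eq0 ![1 == _]eq_sym (negPf x_neq1).
Qed.

Lemma gap_poly_at0 : (gap_poly R S).[0] = 1.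
Proof.
rewrite /gap_poly fsbig_finite// !hornerE horner_sum big_seq big1 ?mulr0 ?subr0 ?opprK ?addr0//.
move=> t; rewrite in_fset_set// in_setD hornerXn => /andP[/set_mem t_gt0 _].
by rewrite expr0n gtn_eqF.
Qed.

Lemma gap_poly_root_itv b : 0 < b -> (gap_poly R S).[b] <= 0 ->
  exists2 x, 0 <= x <= b & root (gap_poly R S) x.
Proof.
move=> b_gt0 Pb.
have [||x xb] := @poly_ivt R (- gap_poly R S) 0 b; first exact: ltW.
  by rewrite !hornerN gap_poly_at0 oppr_le0 ler01 oppr_ge0.
by rewrite rootN; exists x.
Qed.

Lemma smallest_root_norm_lt1 p : smallest_root S p -> `|p| < 1.
Proof.
move=> [_ p_min].
have P1 : (gap_poly R S).[1] = -1 by rewrite /gap_poly !hornerE subrr mul0r subr0 sub0r.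
have [||x /andP[x0 x1] x_root] := @gap_poly_root_itv 1 => //; first by rewrite P1 oppr_le0.
have := p_min _ (proj2 (f_root_realC x) x_root); rewrite !normcR lecR => /le_lt_trans; apply.
rewrite ger0_norm// lt_neqAle x1 andbT; apply: contraTneq x_root => ->.
by rewrite /root P1 oppr_eq0 oner_eq0.
Qed.

(* The inequality is strict because [S] contains an odd number. *)
Lemma moment0_part_gf_ltN x : 0 < x < 1 ->
  binomial_moment 0 (sigma (- x)) < binomial_moment 0 (sigma x).
Proof.
move=> /andP[x_gt0 x_lt1].
have [|s s_gt1 sigma_x] := @part_gf_summable S R x _ (normr1_le_natS R).
  by rewrite gtr0_norm.
have sigma_Nx : sigma (- x) \is a wsummable s.
  apply: le_wsummable sigma_x => k; rewrite /part_gf.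
  by case: ifP; rewrite // !mul1r !normrX normrN.
have [N S_large] := cofinite_eventually gaps_fin.
rewrite -subr_gt0 -(momentB s_gt1)//.
apply: (@moment_gt0 _ s s_gt1 0 N.*2.+1) => //; first by rewrite rpredB.
  move=> k; rewrite !fpsE /part_gf; case: ifP => _; last by rewrite subrr.
  rewrite !mul1r subr_ge0; apply: le_trans (ler_norm _) _.
  by rewrite normrX normrN gtr0_norm.
rewrite !fpsE /part_gf S_large; last by rewrite ltnS -addnn leq_addr.
rewrite !mul1r exprNn -signr_odd /= odd_double expr1 mulN1r opprK.
by rewrite addr_gt0// exprn_gt0.
Qed.

(* A negative root [p] of [f] gives [f (- p) < f p = 0], hence a root of [f]
   in [(0, - p)], of smaller modulus. *)
Lemma smallest_root_ge0 p : smallest_root S p -> 0 <= p.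
Proof.
move=> p_small; have [/f_root_realC p_root p_min] := p_small.
have p_norm := smallest_root_norm_lt1 p_small.
rewrite leNgt; apply/negP => p_lt0; move: (p_norm); rewrite ltr0_norm// => Np_lt1.
have Np_gt0 : 0 < - p by rewrite oppr_gt0.
have gap_poly_Np : (gap_poly R S).[- p] < 0.
  rewrite horner_gap_poly ?normrN// pmulr_rlt0 ?subr_gt0// subr_lt0.
  have := @moment0_part_gf_ltN (- p); rewrite opprK Np_gt0 => /(_ Np_lt1).
  by move: p_root; rewrite root_gap_poly// => /eqP ->.
have [x /andP[x_ge0 x_le] x_root] := gap_poly_root_itv Np_gt0 (ltW gap_poly_Np).
have := p_min _ (proj2 (f_root_realC x) x_root).
rewrite !normcR lecR (ltr0_norm p_lt0) ger0_norm// => x_ge.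
have xE : x = - p by apply/eqP; rewrite eq_le x_le x_ge.
by move: x_root gap_poly_Np; rewrite xE => /eqP ->; rewrite ltxx.
Qed.

Lemma smallest_root_itv p : smallest_root S p -> 0 < p < 1.
Proof.
move=> p_small; have p_ge0 := smallest_root_ge0 p_small.
have := smallest_root_norm_lt1 p_small; rewrite ger0_norm// => ->.
rewrite andbT lt_def p_ge0 andbT; have [p_root _] := p_small.
apply: contraTneq p_root => ->; apply/negP => /f_root_realC.
by rewrite /root gap_poly_at0 oner_eq0.
Qed.

Lemma root_scaled_gap_poly p z :
  root (map_poly (real_complex R) (gap_poly R S \Po (p *: 'X))) z <-> f_root S (p%:C * z).
Proof.
rewrite /f_root -[f_num R S]/(gap_poly R[i] S) map_comp_poly map_gap_poly// rootE horner_comp.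
by rewrite map_polyZ map_polyX hornerZ hornerX.
Qed.

End RootLocation.

(** * Asymptotics of the expectation *)

Section Asymptotics.
Local Open Scope complex_scope.
Variables (R : realType) (S : set nat) (p : R).
Hypotheses (S_pos : S `<=` positive_integers) (gaps_fin : finite_set (gaps S)).
Hypothesis p_small : smallest_root S p.

Local Notation sigma := (part_gf S p (fun=> 1)).
Local Notation count := (comp_gf S p (fun=> 1)).

Let p_gt0 : 0 < p.
Proof. by have /andP[] := smallest_root_itv S_pos gaps_fin p_small. Qed.

Let p_lt1 : p < 1.
Proof. by have /andP[] := smallest_root_itv S_pos gaps_fin p_small. Qed.

Lemma moment0_sigma : binomial_moment 0 sigma = 1.
Proof.
apply/eqP; rewrite -root_gap_poly ?gtr0_norm//.
by have [/(f_root_realC gaps_fin)] := p_small.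
Qed.

Lemma moment1_sigma_gt0 : 0 < binomial_moment 1 sigma.
Proof.
have [N S_large] := cofinite_eventually gaps_fin.
apply: (@part_gf_moment_gt0 S R 1 N.+1); rewrite ?p_gt0 ?S_large//.
by move=> i; rewrite ler01 ler1n.
Qed.

Lemma mean_sigma : series_over S (fun k => k%:R * p ^+ k) = binomial_moment 1 sigma.
Proof. by rewrite moment1_part_gf; congr series_over; apply/funext => k; rewrite mulr1. Qed.

Lemma second_moment_sigma :
  series_over S (fun k => k%:R ^+ 2 * p ^+ k) =
  binomial_moment 2 sigma *+ 2 + binomial_moment 1 sigma.
Proof.
have [|s s_gt1 sigma_sum] := @part_gf_summable S R p _ (normr1_le_natS R).
  by rewrite gtr0_norm.
rewrite -(second_moment s_gt1)// -(series_over_part_gf S (fun k => k%:R ^+ 2)).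
by congr series_over; apply/funext => k; rewrite mul1r.
Qed.

Lemma gap_poly_factor : exists2 Q : {poly R},
  gap_poly R S \Po (p *: 'X) = Q * ('X - 1%:P) &
  Q%:FPS = - ((1 - p *: 'X)%:FPS * fps_tail sigma).
Proof.
have p_root : root (gap_poly R S \Po (p *: 'X)) 1.
  rewrite rootE horner_comp hornerZ hornerX mulr1.
  by have [/(f_root_realC gaps_fin)/eqP ->] := p_small.
have [Q QE] := factor_theorem _ _ p_root.
exists Q => //; apply: nabla_inj.
have := part_gf_gap_poly S_pos gaps_fin p; rewrite QE polyC1.
rewrite -[1 - sigma](_ : nabla * fps_tail sigma = _); last first.
  by rewrite nabla_tail moment0_sigma rmorph1.
rewrite !(rmorphM, rmorphB, rmorph1) /= /nabla => QE'.
transitivity (- (Q%:FPS * ('X%:FPS - 1))); first by ring.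
by rewrite -QE'; ring.
Qed.

Section ErrorTerm.
Variables q r : R.
Hypothesis r_second : second_root_magnitude S p r.
Hypotheses (pq : p < q) (q_lt1 : q < 1) (qr : q < r).

Local Notation s := (q / p).
Let s_gt1 : 1 < s. Proof. by rewrite ltr_pdivlMr// mul1r. Qed.

Lemma norm_root_ratio_lt1 : `|p * s| < 1.
Proof. by rewrite mulrC divfK ?gt_eqF// gtr0_norm// (lt_trans p_gt0). Qed.

Lemma wsummable_nabla_count : nabla * count \is a wsummable s.
Proof.
have [Q QE Q_fps] := gap_poly_factor.
have sigma_sum := wsummable_part_gf S (normr1_le_natS R) norm_root_ratio_lt1.
have Q1 : Q.[1] != 0.
  rewrite -moment0_poly Q_fps -mulNr -rmorphN.
  rewrite (moment0M s_gt1) ?wsummable_poly ?(wsummable_tail s_gt1)//.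
  rewrite moment0_poly (moment_tail s_gt1)// !hornerE.
  apply: mulf_neq0; first by rewrite opprB subr_eq0 lt_eqF.
  by rewrite gt_eqF// moment1_sigma_gt0.
apply: (@wsummable_divp_real _ _ Q); first by apply: contraNneq Q1 => ->; rewrite horner0.
  move=> z Qz; have [_ r_min] := r_second.
  have pz_root : f_root S (p%:C * z).
    by apply/(root_scaled_gap_poly gaps_fin); rewrite QE rmorphM /= rootM Qz.
  have pz_neq : p%:C * z != p%:C.
    apply: contraNneq Q1 => pz; rewrite -rootE -(fmorph_root (real_complex R)) rmorph1.
    suff <- : z = 1 by [].
    by apply: (mulfI (_ : p%:C != 0)); rewrite ?mulr1// fmorph_eq0 gt_eqF.
  have := r_min _ pz_root pz_neq; rewrite normrM !normcR (gtr0_norm p_gt0) => r_le.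
  rewrite -(ltr_pM2l (_ : 0 < p%:C)) ?ltcR//; apply: lt_le_trans r_le.
  rewrite -rmorphM /= ltcR gtr0_norm ?(lt_trans ltr01)//.
  by rewrite mulrC divfK// gt_eqF.
rewrite (_ : Q%:FPS * _ = (- (1 - p *: 'X))%:FPS); first exact: wsummable_poly.
rewrite rmorphN /= Q_fps mulNr -mulrA; congr (- _).
rewrite (tail_renewal_inv _ moment0_sigma (count_renewal S_pos p))//.
by rewrite mulr1.
Qed.

Lemma expectation_part_sum_eqaddO (w : nat -> R) : part_gf S p w \is a wsummable s ->
  (fun n => uniform_expectation (compositions S n) (part_sum w)) =
  (fun n => series_over S (fun k => w k * p ^+ k) /
              series_over S (fun k => k%:R * p ^+ k) * n%:R +
    (series_over S (fun k => w k * p ^+ k) * series_over S (fun k => k%:R ^+ 2 * p ^+ k) /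
       series_over S (fun k => k%:R * p ^+ k) ^+ 2 -
     series_over S (fun k => k%:R * w k * p ^+ k) / series_over S (fun k => k%:R * p ^+ k)))
  +O_\oo (fun n => n%:R * (p / q) ^+ n : R).
Proof.
move=> w_sum; have sigma_sum := wsummable_part_gf S (normr1_le_natS R) norm_root_ratio_lt1.
have := renewal_ratio s_gt1 sigma_sum w_sum wsummable_nabla_count erefl moment0_sigma
  (count_renewal S_pos p) (part_sum_renewal S_pos p w).
have -> : (fun n => uniform_expectation (compositions S n) (part_sum w)) =
    (fun n => comp_gf S p (part_sum w) n / count n).
  by apply/funext => n; rewrite -expectation_part_sum ?gt_eqF.
by rewrite invf_div second_moment_sigma mean_sigma -moment0_part_gf -(moment1_part_gf _ _ w).
Qed.

End ErrorTerm.
End Asymptotics.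

Theorem theorem6 (R : realType) (S : set nat) (p r : R)
    (hS : proper_cofinite S)
    (hp : smallest_root S p)
    (hr : second_root_magnitude S p r) :
  exists a1 a0 : R,
    [/\ 0 < a1,
        a1 = series_over S (fun k => ln k%:R * p ^+ k) /
             series_over S (fun k => k%:R * p ^+ k),
        a0 = series_over S (fun k => ln k%:R * p ^+ k) *
             series_over S (fun k => k%:R ^+ 2 * p ^+ k) /
             series_over S (fun k => k%:R * p ^+ k) ^+ 2 -
             series_over S (fun k => k%:R * ln k%:R * p ^+ k) /
             series_over S (fun k => k%:R * p ^+ k) &
        forall q : R, p < q -> q < Num.min 1 r ->
          (fun n : nat => uniform_expectation (compositions S n)
                      (fun l => ln (part_product l)%:R : R)) =
          (fun n : nat => a1 * n%:R + a0)
            +O_\oo (fun n : nat => n%:R * (p / q) ^+ n : R)].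
Proof.
have [S_pos gaps_fin _] := hS.
eexists; eexists; split; [|reflexivity|reflexivity|].
  rewrite divr_gt0 ?(mean_sigma, moment1_sigma_gt0)//.
  have [N S_large] := cofinite_eventually gaps_fin.
  rewrite -moment0_part_gf (@part_gf_moment_gt0 S R 0 N.+2) ?S_large ?ln_gt0 ?ltr1n//.
    exact: smallest_root_itv hp.
  exact: ln_nat_itv.
move=> q pq; rewrite lt_min => /andP[q_lt1 qr].
rewrite (funext (expectation_ln_part_product _ S_pos)).
apply: (expectation_part_sum_eqaddO S_pos gaps_fin hp hr pq q_lt1 qr).
apply: wsummable_part_gf => [k|]; last exact: (norm_root_ratio_lt1 S_pos gaps_fin hp).
by have /andP[ln_ge0 ln_le] := ln_nat_itv R k; rewrite ger0_norm.
Qed.
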